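(* The Khovanov invariant is strictly stronger than the Jones polynomial: the knots $5_1$ and $10_{132}$ satisfy $$J(5_1)=J(10_{132})\qquad\text{whereas}\qquad \mathrm{Kh}_{\mathbb{Q}}(5_1)\neq \mathrm{Kh}_{\mathbb{Q}}(10_{132}).$$
   Context: Knots are named as in Rolfsen's knot table. Each of $5_1$ and $10_{132}$ is taken with the chirality (of the two mirror images) for which $\mathrm{Kh}_{\mathbb{Q}}$ contains only non-positive powers of $t$ (so $5_1$ is the left-handed $(2,5)$ torus knot). **Link projections and smoothings.** Let $L$ be a planar projection of an oriented link, $\mathcal{X}$ its set of crossings, numbered $1,\dots,n$, $n=|\mathcal{X}|=n_++n_-$, with $n_+$ (resp. $n_-$) the number of right-handed (resp. left-handed) crossings. Each crossing has a 0-smoothing and a 1-smoothing. For a crossing drawn so that the over-strand runs from upper left to lower right, the 0-smoothing is the one consisting of an upper arc and a lower arc ($\asymp$), and the 1-smoothing is the one consisting of a left arc and a right arc ($)($). Equivalently, the 0-smoothing joins the two regions swept when the over-strand is rotated counterclockwise to the under-strand, and the 1-smoothing joins the other two regions. For $\alpha\in\{0,1\}^{\mathcal{X}}$, $S_\alpha$ is the complete smoothing of $L$ (a union of disjoint planar cycles) obtained by smoothing each crossing according to $\alpha$. The height of $\alpha$ is $|\alpha|=\sum_i\alpha_i$. **Jones polynomial.** The Kauffman bracket $\langle L\rangle\in\mathbb{Z}[q,q^{-1}]$ is defined by $\langle\emptyset\rangle=1$, $\langle\bigcirc L\rangle=(q+q^{-1})\langle L\rangle$ (where $\bigcirc$ is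 a disjoint crossingless circle), and $\langle L\rangle=\langle L_0\rangle-q\langle L_1\rangle$, where $L_0,L_1$ are the 0- and 1-smoothings of $L$ at a given crossing. Put $\hat{J}(L)=(-1)^{n_-}q^{n_+-2n_-}\langle L\rangle$; the Jones polynomial is $J(L)=\hat{J}(L)/(q+q^{-1})$. **Khovanov invariant.** All vector spaces are over $\mathbb{Q}$. For a graded vector space $W=\bigoplus_m W_m$, $q\dim W=\sum_m q^m\dim W_m$, and $W\{l\}_m=W_{m-l}$. Let $V$ be the graded vector space with basis $v_+,v_-$ of degrees $+1,-1$. For $\alpha\in\{0,1\}^{\mathcal{X}}$ let $V_\alpha(L)=V^{\otimes k}\{|\alpha|\}$, where $k$ is the number of cycles of $S_\alpha$, the tensor factors being put in bijection with those cycles. Set $[[L]]^r=\bigoplus_{|\alpha|=r}V_\alpha(L)$. Edges of the cube $\{0,1\}^{\mathcal{X}}$ are labeled by $\xi\in\{0,1,\star\}^{\mathcal{X}}$ with exactly one $\star$; the tail (resp. head) of $\xi$ is obtained by $\star\to0$ (resp. $\star\to1$), $|\xi|$ is the height of the tail, and $(-1)^\xi=(-1)^{\sum_{i<j}\xi_i}$, where $j$ is the position of $\star$. Passing from tail to head, either two cycles merge into one or one cycle splits into two. The map $d_\xi$ from the space at the tail to the space at the head is the identity on tensor factors of the cycles not involved, and on the involved factors is $m:V\otimes V\to V$ for a merge and $\Delta:V\to V\otimes V$ for a split, where $$m:\ v_+\otimes v_+\mapsto v_+,\quad v_+\otimes v_-\mapsto v_-,\quad v_-\otimes v_+\mapsto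 v_-,\quad v_-\otimes v_-\mapsto0,$$ $$\Delta:\ v_+\mapsto v_+\otimes v_-+v_-\otimes v_+,\quad v_-\mapsto v_-\otimes v_-.$$ The differential is $d^r=\sum_{|\xi|=r}(-1)^\xi d_\xi:[[L]]^r\to[[L]]^{r+1}$; it makes $[[L]]$ a chain complex of graded vector spaces. The complex $\mathcal{C}(L)$ is obtained from $[[L]]$ by placing $[[L]]^r\{n_+-2n_-\}$ in height $r-n_-$. Let $\mathcal{H}^r(L)$ be its $r$th cohomology, a graded vector space, and $$\mathrm{Kh}_{\mathbb{Q}}(L)=\sum_r t^r\,q\dim\mathcal{H}^r(L).$$ Both $J(L)$ and $\mathrm{Kh}_{\mathbb{Q}}(L)$ are invariants of the oriented link, independent of the chosen projection, and $\mathrm{Kh}_{\mathbb{Q}}(L)$ at $t=-1$ equals $\hat{J}(L)=(q+q^{-1})J(L)$. *)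

(* Defs.v *)
From HB Require Import structures.
From mathcomp Require Import all_boot all_order all_algebra.

Set Implicit Arguments.
Unset Strict Implicit.
Unset Printing Implicit Defensive.

Import Order.TTheory GRing.Theory Num.Theory.
Local Open Scope ring_scope.

(** * Link projections *)

(** [n_components r] is the number of classes of the equivalence relation
    generated by [r]. *)
Definition symc (T : Type) (r : rel T) : rel T := [rel x y | r x y || r y x].
Definition n_components (T : finType) (r : rel T) : nat :=
  n_comp (symc r) predT.

(** A crossing of an oriented projection with edges in [E].  As in the usual
    planar-diagram notation X[i,j,k,l], the four edges are listed
    counterclockwise starting from the incoming end of the under-strand; so the
    under-strand runs from [e0] to [e2], and the over-strand from [e3] to [e1]
    if the crossing is right-handed, from [e1] to [e3] if it is left-handed. *)
Record crossing (E : Type) := Crossing {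
  right_handed : bool;
  e0 : E; e1 : E; e2 : E; e3 : E }.

Section Crossing.
Variables (E : Type) (c : crossing E).

Definition ends : 4.-tuple E := [tuple e0 c; e1 c; e2 c; e3 c].

Definition incoming : seq E :=
  [:: e0 c; if right_handed c then e3 c else e1 c].
Definition outgoing : seq E :=
  [:: e2 c; if right_handed c then e1 c else e3 c].

(** The over-strand [e1]-[e3], rotated counterclockwise to the under-strand,
    sweeps the region between [e1] and [e2] and the one between [e3] and [e0].
    Joining these two regions leaves the arcs [e0]-[e1] and [e2]-[e3]. *)
Definition smoothing (b : bool) : seq (E * E) :=
  if b then [:: (e0 c, e3 c); (e1 c, e2 c)]
  else [:: (e0 c, e1 c); (e2 c, e3 c)].
End Crossing.

Section Wellformed.
Variables (n m : nat) (X : n.-tuple (crossing 'I_m)).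

(** Each edge leaves one crossing and enters one crossing; an edge occurring at
    no crossing is a crossingless circle. *)
Definition oriented_pd : bool :=
  let ins := flatten [seq incoming c | c <- X] in
  let outs := flatten [seq outgoing c | c <- X] in
  uniq ins && perm_eq ins outs.

(** Corner [(i, k)] lies between the ends [k] and [k + 1] of the [i]-th
    crossing.  Follow the edge leaving through the end [k + 1] until it
    arrives at some crossing [j] through the end [l]: the region on its right is
    the one at the corner [(i, k)] and at the corner [(j, l)]. *)
Definition same_region : rel ('I_n * 'I_4) := fun x y =>
  (tnth (ends (tnth X x.1)) (ordS x.2) == tnth (ends (tnth X y.1)) y.2)
  && ((x.1, ordS x.2) != y).

Definition share_edge : rel 'I_n := fun i j =>
  has (mem (ends (tnth X i))) (ends (tnth X j)).

(** Euler's formula [n - 2n + F = 2C] for the 4-valent graph formed by the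
    crossings: each of its [C] connected components has genus 0. *)
Definition planar_pd : bool :=
  n_components same_region == (n + 2 * n_components share_edge)%N.
End Wellformed.

(** A planar projection of an oriented link, its crossings being numbered. *)
Record projection := Projection {
  n_cross : nat;
  n_edges : nat;
  cross : n_cross.-tuple (crossing 'I_n_edges);
  oriented_cross : oriented_pd cross;
  planar_cross : planar_pd cross }.

Definition n_plus (L : projection) : nat :=
  count (fun c => right_handed c) (cross L).
Definition n_minus (L : projection) : nat :=
  count (fun c => ~~ right_handed c) (cross L).

(** * Cycles of a smoothing *)

(** Once all crossings are smoothed, the edges are joined end to end by a list
    of pairs [js]; the cycles are the classes of edges that [js] generates. *)
Definition joined (E : eqType) (js : seq (E * E)) : rel E :=
  symc [rel e f | (e, f) \in js].
Definition same_cycle (E : finType) (js : seq (E * E)) : rel E :=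
  connect (joined js).

(** * Jones polynomial *)

(** Laurent polynomials in [t] and [q] are taken in the field Q(t, q), the
    fraction field of Z[q][t]. *)
Definition ratfun : fieldType := {fraction {poly {poly int}}}.
Definition t : ratfun := tofrac ('X : {poly {poly int}}).
Definition q : ratfun := tofrac (('X : {poly int})%:P : {poly {poly int}}).

(** Bracket of the partially smoothed projection with remaining crossings [cs]
    and arcs [js] created so far.  The first crossing is resolved by the rule
    <L> = <L_0> - q <L_1>; without crossings there remain disjoint circles, each
    contributing a factor [q + q^-1]. *)
Fixpoint bracket (E : finType) (cs : seq (crossing E)) (js : seq (E * E))
    : ratfun :=
  if cs is c :: cs' then
    bracket cs' (js ++ smoothing c false)
      - q * bracket cs' (js ++ smoothing c true)
  else (q + q^-1) ^+ n_components [rel e f | (e, f) \in js].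

Definition kauffman (L : projection) : ratfun := bracket (cross L) [::].

Definition Jhat (L : projection) : ratfun :=
  (-1) ^+ n_minus L * q ^ ((n_plus L)%:Z - 2 * (n_minus L)%:Z) * kauffman L.

Definition jones (L : projection) : ratfun := Jhat L / (q + q^-1).

(** * Khovanov invariant *)

(** [true] and [false] stand for the basis vectors v_+ and v_- of V.
    [mV x y] lists the basis vectors whose sum is m(x (x) y), and [DeltaV x]
    the basis tensors whose sum is Delta(x). *)
Definition mV (x y : bool) : seq bool :=
  match x, y with
  | true, true => [:: true]
  | true, false | false, true => [:: false]
  | false, false => [::]
  end.
Definition DeltaV (x : bool) : seq (bool * bool) :=
  if x then [:: (true, false); (false, true)] else [:: (false, false)].

Section Khovanov.
Variable L : projection.
Local Notation n := (n_cross L).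
Local Notation edge := 'I_(n_edges L).
Local Notation X := (tnth (cross L)).

Definition vertex := {ffun 'I_n -> bool}.
Definition weight (a : vertex) : nat := (\sum_i a i)%N.
Definition joins (a : vertex) : seq (edge * edge) :=
  flatten [seq smoothing (X i) (a i) | i <- enum 'I_n].

(** The basis of the direct sum of all V_alpha: a vertex [alpha] and a choice of
    v_+ or v_- for each cycle of S_alpha, given as a function on the edges which
    is constant along the cycles. *)
Definition labels_cycles (x : vertex * {ffun edge -> bool}) : bool :=
  [forall e, forall f, ((e, f) \in joins x.1) ==> (x.2 e == x.2 f)].
Definition state := {x : vertex * {ffun edge -> bool} | labels_cycles x}.
Definition vert (x : state) : vertex := (val x).1.
Definition label (x : state) : {ffun edge -> bool} := (val x).2.

(** Height and degree in C(L), including the shifts by [- n_-], [|alpha|] and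
    [n_+ - 2 n_-].  The sum has one term for each cycle. *)
Definition height (x : state) : int := (weight (vert x))%:Z - (n_minus L)%:Z.
Definition degree (x : state) : int :=
  \sum_(e | e \in roots (joined (joins (vert x))))
      (if label x e then 1 else -1)
  + (weight (vert x))%:Z + ((n_plus L)%:Z - 2 * (n_minus L)%:Z).

(** [arrow j a b]: there is an edge of the cube from [a] to [b], with its star at
    position [j]. *)
Definition arrow (j : 'I_n) (a b : vertex) : bool :=
  [&& ~~ a j, b j & [forall i, (i != j) ==> (a i == b i)]].

Definition arrow_sign (j : 'I_n) (a : vertex) : rat :=
  (-1) ^+ (\sum_(i < n | (i < j)%N) a i)%N.

(** Matrix entry of d_xi from [x] to [y], for the edge xi of the cube with star
    at [j].  The cycles involved are those through [e0] and [e2] of the [j]-th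
    crossing: at the tail they are distinct for a merge and equal for a split,
    and conversely at the head. *)
Definition dxi_entry (j : 'I_n) (x y : state) : rat :=
  let cyc := same_cycle (joins (vert x)) in
  let e := e0 (X j) in
  let f := e2 (X j) in
  if [forall g, ~~ cyc e g && ~~ cyc f g ==> (label x g == label y g)]
  then (if cyc e f
        then (label y e, label y f) \in DeltaV (label x e)
        else label y e \in mV (label x e) (label x f))%:R
  else 0.

Definition d_entry (x y : state) : rat :=
  \sum_(j | arrow j (vert x) (vert y)) arrow_sign j (vert x) * dxi_entry j x y.

(** The sum of all chain spaces, in coordinates on the basis [state], and the
    sum of all differentials. *)
Definition chains := {ffun state -> rat^o}.

Definition d_fun (z : chains) : chains :=
  [ffun y => \sum_x d_entry x y * z x].

Fact d_fun_linear : linear d_fun.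
Proof.
move=> k u v; apply/ffunP=> y; rewrite !ffunE scaler_sumr -big_split /=.
apply: eq_bigr => x _; rewrite !ffunE mulrDr; congr (_ + _).
by rewrite /GRing.scale /= mulrCA.
Qed.
HB.instance Definition _ :=
  GRing.isLinear.Build rat chains chains _ d_fun d_fun_linear.

Definition d : 'End(chains) := linfun d_fun.

Definition basis_chain (x : state) : chains := [ffun y => (y == x)%:R].

(** Degree [m] part of the chain space at height [r]. *)
Definition chains_at (r m : int) : {vspace chains} :=
  (\sum_(x : state | (height x == r) && (degree x == m)) <[basis_chain x]>)%VS.

(** Degree [m] part of the [r]-th cohomology: the quotient of cocycles by
    coboundaries, realized as a complement of the latter in the former. *)
Definition cohomology (r m : int) : {vspace chains} :=
  ((lker d :&: chains_at r m) :\: (d @: chains_at (r - 1) m))%VS.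

(** The sums over [r] and [m] are restricted to the finitely many heights and
    degrees in which the chain space is nonzero. *)
Definition qdim_cohomology (r : int) : ratfun :=
  \sum_(m <- undup [seq degree x | x : state])
     q ^ m * (\dim (cohomology r m))%:R.

Definition Kh : ratfun :=
  \sum_(r <- undup [seq height x | x : state]) t ^ r * qdim_cohomology r.
End Khovanov.

(** * The knots 5_1 and 10_132 *)

(** Planar-diagram codes of the projections in Rolfsen's table, up to mirror
    image: of the two chiralities, these are the ones whose [Kh] has no positive
    power of [t].  Edge labels are read modulo the number [m.+1] of edges. *)
Definition Xp m (i j k l : nat) : crossing 'I_m.+1 :=
  Crossing true (inZp i) (inZp j) (inZp k) (inZp l).
Definition Xm m (i j k l : nat) : crossing 'I_m.+1 :=
  Crossing false (inZp i) (inZp j) (inZp k) (inZp l).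

Definition pd_5_1 : 5.-tuple (crossing 'I_10) :=
  [tuple Xm 9 1 6 2 7; Xm 9 3 8 4 9; Xm 9 5 10 6 1; Xm 9 7 2 8 3;
         Xm 9 9 4 10 5].

(** The Dowker-Thistlethwaite code of this projection is
    [4 8 -12 2 -16 -6 -20 -18 -10 -14]. *)
Definition pd_10_132 : 10.-tuple (crossing 'I_20) :=
  [tuple Xp 19 4 2 5 1; Xp 19 8 4 9 3; Xm 19 5 12 6 13; Xm 19 15 18 16 19;
         Xm 19 9 16 10 17; Xm 19 17 10 18 11; Xm 19 13 20 14 1;
         Xm 19 19 14 20 15; Xm 19 11 6 12 7; Xp 19 2 8 3 7].

Fact oriented_5_1 : oriented_pd pd_5_1. Proof. by vm_compute. Qed.
Fact oriented_10_132 : oriented_pd pd_10_132. Proof. by vm_compute. Qed.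

(** The classes of [r] can be counted by exhibiting for each of them a walk which
    visits all its elements. *)
Lemma n_components_walks (T : finType) (r : rel T) (en : seq T)
    (bs : seq (seq T)) (lab := fun x : T => find (fun b => x \in b) bs) :
  (forall x, x \in en) ->
  all (fun b => if b is x :: p then path (symc r) x p else false) bs ->
  all (fun x => lab x < size bs)%N en ->
  all (fun x => all (fun y => r x y ==> (lab x == lab y)) en) en ->
  map (fun b => if b is x :: _ then lab x else 0%N) bs = iota 0 (size bs) ->
  n_components r = size bs.
Proof.
move=> enT walks labT labr heads.
have symr : connect_sym (symc r).
  by apply: sym_connect_sym => x y; rewrite /symc /= orbC.
have lab_r x y : symc r x y -> lab x = lab y.
  have labr' u v : r u v -> lab u = lab v.
    by move=> ruv; have /allP/(_ v (enT v)) := allP labr u (enT u);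
      rewrite ruv => /eqP.
  by case/orP=> /labr'.
have lab_c x y : connect (symc r) x y -> lab x = lab y.
  case/connectP=> p; elim: p x => [|z p IHp] x /=; first by move=> _ ->.
  by case/andP=> /lab_r-> /IHp.
have lab_lt x : (lab x < size bs)%N by apply: (allP labT).
case E: bs => [|b0 bs0].
  apply: eq_card0 => x; have := lab_lt x; by rewrite E.
have [x0 _] : exists x0 : T, True.
  by move: walks; rewrite E; case: (b0) => // x0 *; exists x0.
pose hd i := head x0 (nth [::] bs i).
have hdP i : (i < size bs)%N -> lab (hd i) = i.
  move=> lti; have := congr1 (fun s => nth 0%N s i) heads.
  rewrite (nth_map [::]) // nth_iota // add0n /hd.
  by have := allP walks _ (mem_nth [::] lti); case: (nth _ _ _).
have hdc x : connect (symc r) (hd (lab x)) x.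
  have hasx : has (fun b => x \in b) bs by rewrite has_find; apply: lab_lt.
  have := nth_find [::] hasx; rewrite /hd -/(lab x).
  have := allP walks _ (mem_nth [::] (lab_lt x)).
  case: (nth _ _ _) => //= y p yp xp.
  by apply: (path_connect yp).
rewrite -E /n_components /n_comp_mem.
pose s := [seq fingraph.root (symc r) (hd i) | i <- iota 0 (size bs)].
have us : uniq s.
  rewrite map_inj_in_uniq ?iota_uniq // => i j.
  rewrite !mem_iota /= !add0n => lti ltj /eqP.
  rewrite fingraph.root_connect // => /lab_c; by rewrite !hdP.
transitivity (size s); last by rewrite size_map size_iota.
rewrite -(card_uniqP us); apply: eq_card => x; rewrite !inE andbT.
apply/idP/mapP => [rx | [i _ ->]]; last exact: roots_root.
exists (lab x); first by rewrite mem_iota /= add0n.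
by rewrite -[LHS](eqP rx); apply/eqP; rewrite fingraph.root_connect // symr hdc.
Qed.

Lemma mem_inZp n (i : 'I_n.+1) : i \in [seq inZp k | k <- iota 0 n.+1].
Proof. by rewrite -[i]valZpK map_f // mem_iota /= add0n ltn_ord. Qed.

Lemma mem_inZp2 n m (x : 'I_n.+1 * 'I_m.+1) :
  x \in [seq (i, j) | i <- [seq inZp k | k <- iota 0 n.+1],
                      j <- [seq inZp k | k <- iota 0 m.+1]].
Proof. by case: x => i j; apply/allpairs_f; apply: mem_inZp. Qed.

Definition corners n (s : seq (seq (nat * nat))) : seq (seq ('I_n.+1 * 'I_4)) :=
  [seq [seq (inZp x.1, inZp x.2) | x <- b] | b <- s].

Fact planar_5_1 : planar_pd pd_5_1.
Proof.
have faces : n_components (same_region pd_5_1) = 7%N.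
  by apply: (@n_components_walks _ _ _ (corners 4
    [:: [:: (0,0); (2,2)]; [:: (0,1); (3,1); (1,1); (4,1); (2,1)];
        [:: (0,2); (3,0)]; [:: (0,3); (2,3); (4,3); (1,3); (3,3)];
        [:: (1,0); (3,2)]; [:: (1,2); (4,0)]; [:: (2,0); (4,2)]]%N)
    (@mem_inZp2 4 3)); vm_compute.
have connected : n_components (share_edge pd_5_1) = 1%N.
  by apply: (@n_components_walks _ _ _
    [:: [seq inZp k | k <- [:: 0; 2; 4; 1; 3]%N]] (@mem_inZp 4)); vm_compute.
by rewrite /planar_pd faces connected.
Qed.

Fact planar_10_132 : planar_pd pd_10_132.
Proof.
have faces : n_components (same_region pd_10_132) = 12%N.
  by apply: (@n_components_walks _ _ _ (corners 9
    [:: [:: (0,0); (9,0); (1,0)]; [:: (0,1); (2,0); (8,2); (9,3)];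
        [:: (0,2); (6,3); (2,3)];
        [:: (0,3); (1,1); (4,0); (3,2); (7,0); (6,2)];
        [:: (1,2); (9,2); (8,3); (5,3); (4,3)]; [:: (1,3); (9,1)];
        [:: (2,1); (8,1)]; [:: (2,2); (6,0); (7,2); (3,0); (5,2); (8,0)];
        [:: (3,1); (4,1); (5,1)]; [:: (3,3); (7,3)]; [:: (4,2); (5,0)];
        [:: (6,1); (7,1)]]%N)
    (@mem_inZp2 9 3)); vm_compute.
have connected : n_components (share_edge pd_10_132) = 1%N.
  by apply: (@n_components_walks _ _ _
    [:: [seq inZp k | k <- [:: 0; 1; 4; 5; 3; 7; 6; 2; 8; 9]%N]]
    (@mem_inZp 9)); vm_compute.
by rewrite /planar_pd faces connected.
Qed.

Definition knot_5_1 : projection := Projection oriented_5_1 planar_5_1.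
Definition knot_10_132 : projection := Projection oriented_10_132 planar_10_132.

(* Main.v *)
Require Import Defs.
From mathcomp Require Import all_boot all_order all_algebra.
From mathcomp Require Import ring zify.

Set Implicit Arguments.
Unset Strict Implicit.
Unset Printing Implicit Defensive.

Import Order.TTheory GRing.Theory Num.Theory.
Local Open Scope ring_scope.

(** The Jones polynomials are compared by evaluating both state sums.  Unfolding
    the bracket relation writes <L> as the sum, over the complete smoothings, of
    (-q)^h (q + q^-1)^k, where h is the height and k the number of circles; a
    smoothing only matters through the pair (h, k), and these pairs, found by
    merging colour classes of edges arc by arc, are tallied by computation
    ([kauffman_state_sum]).  What remains is an identity between rational
    functions of one variable ([state_sum_eq]).

    The Khovanov polynomials differ already in their lowest powers of t.  A
    projection of 5_1 with five negative crossings has no chains below height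
    -5, whereas the projection of 10_132 has seven negative crossings and chains
    at height -7.  In its all-0 smoothing the two arcs at each crossing lie on
    distinct circles, so that every edge of the cube leaving this vertex is a
    merge; since m(v_- (x) v_-) = 0, the chain labelling all circles by v_- is
    a cocycle, and it is not a coboundary because there is nothing in height -8
    ([cohomology_state0]).  Hence the cohomology at height -7 does not vanish.
    That this is visible on the polynomials is [Kh_dim]: a sum of terms
    t^r q^m dim, as an element of Q(t, q), determines all the dimensions. *)

(** * Counting the circles of a smoothing *)

Definition colour n (s : seq nat) (e : 'I_n) : nat := nth 0%N s e.

Definition glue n (s : seq nat) (p : 'I_n * 'I_n) : seq nat :=
  let a := colour s p.1 in let b := colour s p.2 in
  [seq if c == a then b else c | c <- s].

(** [s] lists a colour for each of the [n] edges, two edges having the same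
    colour when the arcs [js] put them on the same circle. *)
Definition colouring n (s : seq nat) (js : seq ('I_n * 'I_n)) : Prop :=
  size s = n /\ forall e f, same_cycle js e f = (colour s e == colour s f).

Lemma joined_connect_sym (E : finType) (js : seq (E * E)) :
  connect_sym (joined js).
Proof. by apply: sym_connect_sym => x y; rewrite /joined /symc /= orbC. Qed.

Lemma colouring_nil n : colouring (iota 0 n) ([::] : seq ('I_n * 'I_n)).
Proof.
split=> [|e f]; first by rewrite size_iota.
rewrite /colour !nth_iota // !add0n; apply/idP/eqP => [|/val_inj->].
  by case/connectP=> [[|x p]] //= _ ->.
exact: connect0.
Qed.

(** One step of union-find: a new arc from [a] to [b] merges the colour class of
    [a] into that of [b]. *)
Lemma colouring_rcons n s (js : seq ('I_n * 'I_n)) p :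
  colouring s js -> colouring (glue s p) (rcons js p).
Proof.
case: p => a b [ss sc]; split=> [|e f]; first by rewrite size_map.
have glueE (g : 'I_n) : colour (glue s (a, b)) g =
    if colour s g == colour s a then colour s b else colour s g.
  by rewrite /colour /glue (nth_map 0%N) ?ss.
have sub : subrel (same_cycle js) (same_cycle (rcons js (a, b))).
  apply: connect_sub => x y xy; apply: connect1; move: xy.
  by rewrite /joined /symc /= !mem_rcons !in_cons => /orP[]->; rewrite ?orbT.
have ab : same_cycle (rcons js (a, b)) a b.
  by apply: connect1; rewrite /joined /symc /= mem_rcons mem_head.
have csym := @joined_connect_sym _ (rcons js (a, b)).
apply/idP/idP.
  case/connectP=> r er ->; elim: r e er => [|g r IHr] e /=.
    by move=> _; apply: eqxx.
  case/andP=> eg /IHr.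
  suff /eqP-> : colour (glue s (a, b)) e == colour (glue s (a, b)) g by [].
  have same x y : (x, y) \in js -> colour s x = colour s y.
    move=> xy; apply/eqP; rewrite -sc; apply: connect1.
    by rewrite /joined /symc /= xy.
  rewrite !glueE; move: eg; rewrite /joined /symc /= !mem_rcons !in_cons.
  by case/orP=> /orP[/eqP[-> ->]|/same->]; rewrite ?if_same ?eqxx /=.
have toa g : (colour s g == colour s a) -> same_cycle (rcons js (a, b)) g b.
  by rewrite -sc => /sub ga; apply: connect_trans ga ab.
have tob g : (colour s b == colour s g) -> same_cycle (rcons js (a, b)) b g.
  by rewrite -sc => /sub.
rewrite !glueE; case: ifP => [/toa eb|_]; case: ifP => [/toa fb|_].
- by move=> _; apply: connect_trans eb _; rewrite csym.
- by move/tob; apply: connect_trans.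
- rewrite eq_sym => /tob; rewrite /same_cycle csym => be.
  by apply: connect_trans be _; rewrite csym.
- by rewrite -sc => /sub.
Qed.

Lemma colouring_cat n s (js ks : seq ('I_n * 'I_n)) :
  colouring s js -> colouring (foldl (@glue n) s ks) (js ++ ks).
Proof.
elim: ks s js => [|p ks IHks] s js /=; first by rewrite cats0.
by rewrite -cat_rcons => /colouring_rcons/IHks.
Qed.

Lemma n_components_colouring n s (js : seq ('I_n * 'I_n)) :
  colouring s js -> n_components [rel e f | (e, f) \in js] = size (undup s).
Proof.
case=> ss sc.
have csym := @joined_connect_sym _ js.
rewrite /n_components /n_comp_mem -/(joined js).
have colour_root e : colour s (fingraph.root (joined js) e) = colour s e.
  by apply/esym/eqP; rewrite -sc; apply: connect_root.
rewrite cardE -(size_map (@colour n s)); apply: perm_size; apply: uniq_perm.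
- rewrite map_inj_in_uniq ?enum_uniq // => e f.
  rewrite !mem_enum !inE !andbT => /eqP re /eqP rf /eqP.
  by rewrite -sc /same_cycle -root_connect // re rf => /eqP.
- exact: undup_uniq.
move=> c; rewrite mem_undup; apply/mapP/idP => [[e _ ->]|cs].
  by apply: mem_nth; rewrite ss.
have lt_cn : (index c s < n)%N by rewrite -ss index_mem.
exists (fingraph.root (joined js) (Ordinal lt_cn)).
  by rewrite mem_enum !inE andbT; apply: roots_root.
by rewrite colour_root /colour /= nth_index.
Qed.

(** * The Kauffman bracket as a sum over smoothings *)

(** The pairs (height, number of circles) of all complete smoothings, with the
    colouring [s] and the height [h] accumulated over the crossings already
    smoothed. *)
Fixpoint smoothings n (cs : seq (crossing 'I_n)) (s : seq nat) (h : nat) :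
    seq (nat * nat) :=
  if cs is c :: cs' then
    smoothings cs' (foldl (@glue n) s (smoothing c false)) h
      ++ smoothings cs' (foldl (@glue n) s (smoothing c true)) h.+1
  else [:: (h, size (undup s))].

Definition smoothing_term (F : fieldType) (x : F) (p : nat * nat) : F :=
  (- x) ^+ p.1 * (x + x^-1) ^+ p.2.

Lemma bracket_smoothings n (cs : seq (crossing 'I_n)) js s h :
  colouring s js ->
  (- q) ^+ h * bracket cs js =
    \sum_(p <- smoothings cs s h) smoothing_term q p.
Proof.
elim: cs js s h => [|c cs IHcs] js s h sj /=.
  by rewrite big_seq1 /smoothing_term (n_components_colouring sj).
rewrite big_cat /= -(IHcs (js ++ smoothing c false));
  last exact: (colouring_cat (smoothing c false) sj).
rewrite -(IHcs (js ++ smoothing c true));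
  last exact: (colouring_cat (smoothing c true) sj).
by rewrite mulrBr exprSr -mulrA mulNr mulrN.
Qed.

Lemma sum_tally (V : nmodType) (T : eqType) (s : seq T) (F : T -> V) :
  \sum_(x <- s) F x = \sum_(p <- tally s) F p.1 *+ p.2.
Proof.
rewrite -(perm_big _ (tallyK s)) /= /tally_seq big_flatten big_map.
by apply: eq_bigr => p _; rewrite big_nseq iter_addr_0.
Qed.

(** Stated over any field, so that the comparison of two state sums is an identity
    in one variable rather than a computation inside Q(t, q). *)
Definition state_sum (F : fieldType) (x : F) (L : projection) : F :=
  \sum_(p <- tally (smoothings (cross L) (iota 0 (n_edges L)) 0))
     smoothing_term x p.1 *+ p.2.

Lemma kauffman_state_sum (L : projection) : kauffman L = state_sum q L.
Proof.
rewrite /state_sum -sum_tally -(@bracket_smoothings _ _ [::]) ?mul1r //.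
exact: colouring_nil.
Qed.

Lemma q_neq0 : q != 0.
Proof. by rewrite tofrac_eq0 polyC_eq0 polyX_eq0. Qed.

(** The prefactors are (-1)^{n_-} q^{n_+ - 2 n_-}, for (n_+, n_-) = (0, 5) and
    (3, 7). *)
Lemma state_sum_eq (F : fieldType) (x : F) : x != 0 ->
  (-1) ^+ 5 * x ^- 10 * state_sum x knot_5_1 =
  (-1) ^+ 7 * x ^- 11 * state_sum x knot_10_132.
Proof.
move=> x0; rewrite /state_sum.
(* The 32 and 1024 smoothings give 6 and 25 distinct pairs. *)
set t5 := tally _; vm_compute in t5; set t10 := tally _; vm_compute in t10.
rewrite /t5 /t10 {t5 t10} !big_cons !big_nil /smoothing_term /=.
by field; exact: x0.
Qed.

Lemma jones_eq : jones knot_5_1 = jones knot_10_132.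
Proof.
congr (_ / _); rewrite /Jhat !kauffman_state_sum.
have -> : n_plus knot_5_1 = 0%N by vm_compute.
have -> : n_minus knot_5_1 = 5%N by vm_compute.
have -> : n_plus knot_10_132 = 3%N by vm_compute.
have -> : n_minus knot_10_132 = 7%N by vm_compute.
exact: state_sum_eq q_neq0.
Qed.

(** * The dimensions read off from the Khovanov polynomial *)

Lemma cohomology_eq0 (L : projection) (r m : int) :
  (forall x : state L, (height x == r) && (degree x == m) = false) ->
  cohomology L r m = 0%VS.
Proof.
move=> noxr; rewrite /cohomology [chains_at L r m]big_pred0 //.
by apply/eqP; rewrite -subv0 (subv_trans (diffvSl _ _)) ?capv0.
Qed.

Lemma sum_undup_delta (V : nmodType) (T : eqType) (s : seq T) y (F : T -> V) :
  \sum_(x <- undup s) F x *+ (y == x) = F y *+ (y \in s).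
Proof.
case: (boolP (y \in s)) => ys /=.
  rewrite (bigD1_seq y) ?mem_undup ?undup_uniq //= eqxx big1 ?addr0 // => x.
  by rewrite eq_sym => /negPf->.
rewrite big_seq big1 // => x; rewrite mem_undup; case: eqP => // <-.
by rewrite (negPf ys).
Qed.

(** [t ^ N * q ^ N * Kh L] as a polynomial, for [N] so large that no negative
    exponents remain. *)
Definition shifted_Kh (L : projection) (N : nat) : {poly {poly int}} :=
  \sum_(r <- undup [seq height x | x : state L]) 'X^(`|(r + N%:Z)%R|) *
    (\sum_(m <- undup [seq degree x | x : state L])
       'X^(`|(m + N%:Z)%R|) *+ \dim (cohomology L r m))%:P.

Definition bounded_by (L : projection) (N : nat) : Prop :=
  forall x : state L, 0 <= height x + N%:Z /\ 0 <= degree x + N%:Z.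

Lemma t_neq0 : t != 0.
Proof. by rewrite tofrac_eq0 polyX_eq0. Qed.

Lemma shifted_KhE (L : projection) (N : nat) : bounded_by L N ->
  tofrac (shifted_Kh L N) = t ^ N%:Z * q ^ N%:Z * Kh L.
Proof.
move=> NL; rewrite /Kh /shifted_Kh rmorph_sum mulr_sumr.
apply: eq_big_seq => r; rewrite mem_undup => /mapP[x _ ->].
have [hx _] := NL x.
have tofracX (R : idomainType) (u : R) (k : int) : 0 <= k ->
    tofrac (u ^+ `|k|) = tofrac u ^ k.
  by move=> k0; rewrite rmorphXn /= -[in RHS](gez0_abs k0).
rewrite rmorphM /= tofracX // -/t mulrACA -(expfzDr _ _ t_neq0) [N%:Z + _]addrC.
congr (_ * _); rewrite /qdim_cohomology mulr_sumr !rmorph_sum.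
apply: eq_big_seq => m; rewrite mem_undup => /mapP[y _ ->].
have [_ dy] := NL y.
rewrite mulrA -(expfzDr _ _ q_neq0) [N%:Z + _]addrC /=.
rewrite !rmorphMn /= [in LHS]rmorphXn /= tofracX //.
by rewrite [RHS]mulr_natr.
Qed.

Lemma coef_shifted_Kh (L : projection) (N : nat) (r m : int) : bounded_by L N ->
  0 <= r + N%:Z -> 0 <= m + N%:Z ->
  (shifted_Kh L N)`_(`|(r + N%:Z)%R|)`_(`|(m + N%:Z)%R|) =
    (\dim (cohomology L r m))%:R.
Proof.
move=> NL r0 m0.
have absE (k l : int) : 0 <= k + N%:Z -> 0 <= l + N%:Z ->
    (`|(k + N%:Z)%R| == `|(l + N%:Z)%R|)%N = (k == l).
  by move=> k0 l0; rewrite -eqz_nat !gez0_abs // (inj_eq (addIr _)).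
rewrite /shifted_Kh !coef_sum.
transitivity (\sum_(k <- undup [seq height x | x : state L])
    (\sum_(l <- undup [seq degree x | x : state L])
       (\dim (cohomology L k l))%:R *+ (m == l) : int) *+ (r == k)).
  apply: eq_big_seq => k; rewrite mem_undup => /mapP[x _ ->].
  have [hx _] := NL x; rewrite coefMC coefXn absE // mulr_natl coefMn coef_sum.
  congr (_ *+ _); apply: eq_big_seq => l; rewrite mem_undup => /mapP[y _ ->].
  by have [_ dy] := NL y; rewrite coefMn coefXn absE // mulrnAC.
rewrite sum_undup_delta sum_undup_delta -mulrnA mulnb.
case out: (_ && _); first by rewrite mulr1n.
(* No term of the sums has bidegree (r, m), so there are no chains there. *)
rewrite cohomology_eq0 ?dimv0 ?mulr0n // => x.
apply/negP => /andP[/eqP hx /eqP dx]; move/negP: out; apply.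
by rewrite -hx -dx; apply/andP; split; apply: map_f; rewrite mem_enum.
Qed.

(** After multiplication by a large power of [t * q], which may be taken the same
    for both projections, the two sides are polynomials and their coefficients
    can be compared. *)
Lemma Kh_dim (L L' : projection) (r m : int) : Kh L = Kh L' ->
  \dim (cohomology L r m) = \dim (cohomology L' r m).
Proof.
move=> KhL.
pose bnd (K : projection) := (\sum_(x : state K) (`|height x| + `|degree x|))%N.
(* [r] and [m] are added to make [r + N] and [m + N] valid exponents. *)
pose N := (bnd L + bnd L' + `|r| + `|m|)%N.
have shift_ge0 (k : int) : (`|k| <= N)%N -> 0 <= k + N%:Z.
  by move=> kN; rewrite -lerBlDr sub0r lerNl; lia.
have bndP (K : projection) : (bnd K <= N)%N -> bounded_by K N.
  move=> KN x; have xK : (`|height x| + `|degree x| <= bnd K)%N.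
    by rewrite /bnd (bigD1 x) //= leq_addr.
  by split; apply: shift_ge0; lia.
have NL : bounded_by L N by apply: bndP; rewrite /N; lia.
have NL' : bounded_by L' N by apply: bndP; rewrite /N; lia.
have r0 : 0 <= r + N%:Z by apply: shift_ge0; rewrite /N; lia.
have m0 : 0 <= m + N%:Z by apply: shift_ge0; rewrite /N; lia.
have /eqP : tofrac (shifted_Kh L N) = tofrac (shifted_Kh L' N).
  by rewrite !shifted_KhE // KhL.
rewrite tofrac_eq => /eqP eqP'.
apply/eqP; rewrite -(eqr_nat int) -(coef_shifted_Kh NL r0 m0).
by rewrite -(coef_shifted_Kh NL' r0 m0) eqP'.
Qed.

(** * The lowest height of an adequate projection *)

Section LowestHeight.
Variable L : projection.

Lemma height_ge (x : state L) : - (n_minus L)%:Z <= height x.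
Proof. by rewrite /height -[leLHS]add0r lerD2r. Qed.

Definition vertex0 : vertex L := [ffun => false].

Lemma joins_vertex0 :
  joins vertex0 = flatten [seq smoothing c false | c <- cross L].
Proof.
rewrite /joins -[in RHS](map_tnth_enum (cross L)) -map_comp.
by congr flatten; apply: eq_map => i /=; rewrite ffunE.
Qed.

Lemma labels_state0 : labels_cycles (vertex0, [ffun => false]).
Proof. by apply/forallP=> e; apply/forallP=> f; rewrite !ffunE eqxx implybT. Qed.

(** The element v_- (x) ... (x) v_- at the all-0 vertex. *)
Definition state0 : state L := Sub (vertex0, [ffun => false]) labels_state0.

Lemma height_state0 : height state0 = - (n_minus L)%:Z.
Proof.
rewrite /height /weight big1 ?sub0r // => i _.
by rewrite /vert SubK ffunE.
Qed.

(** Half of the classical notion of adequacy (the all-1 smoothing satisfies the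
    same condition for the other half): changing any single 0-smoothing into the
    1-smoothing merges two circles. *)
Definition adequate : bool :=
  all (fun c => ~~ same_cycle (joins vertex0) (e0 c) (e2 c)) (cross L).

(** Every edge leaving the all-0 vertex is a merge, and m(v_- (x) v_-) = 0. *)
Lemma d_state0 : adequate -> d L (basis_chain state0) = 0.
Proof.
move=> adq; rewrite lfunE /=; apply/ffunP => y; rewrite !ffunE big1 // => x _.
rewrite ffunE; case: eqP => [->|_]; last by rewrite mulr0.
rewrite mulr1 /d_entry big1 // => j _; rewrite /dxi_entry /vert /label SubK /=.
have /negPf-> := all_tnthP adq j.
by rewrite !ffunE in_nil if_same mulr0.
Qed.

(** The height of [state0] is minimal, so there are no coboundaries to quotient
    by. *)
Lemma cohomology_state0 : adequate ->
  (0 < \dim (cohomology L (- (n_minus L)%:Z) (degree state0)))%N.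
Proof.
move=> adq; set r := - _; set m := degree _.
have no_chains : chains_at L (r - 1) m = 0%VS.
  rewrite /chains_at big_pred0 // => x; apply/negP => /andP[/eqP hx _].
  by have := height_ge x; rewrite hx -/r lerDl oppr_ge0.
have z_in : basis_chain state0 \in (lker (d L) :&: chains_at L r m)%VS.
  rewrite memv_cap memv_ker d_state0 // eqxx /=.
  apply: (subvP (sumv_sup state0 _ (subvv _))); last exact: memv_line.
  by rewrite height_state0 !eqxx.
rewrite /cohomology no_chains limg0.
have diffv0 (V : {vspace chains L}) : (V :\: 0)%VS = V.
  by rewrite -[RHS](addv_diff_cap V 0%VS) capv0 addv0.
rewrite diffv0.
rewrite lt0n dimv_eq0; apply: contraTneq z_in => ->.
rewrite memv0; apply/eqP => /ffunP/(_ state0)/eqP.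
by rewrite !ffunE eqxx oner_eq0.
Qed.
End LowestHeight.

Lemma adequate_10_132 : adequate knot_10_132.
Proof.
rewrite /adequate joins_vertex0.
have [_ sc] := colouring_cat
  (flatten [seq smoothing c false | c <- pd_10_132]) (colouring_nil 20).
by rewrite (eq_all (fun c => congr1 negb (sc (e0 c) (e2 c)))); vm_compute.
Qed.

Theorem mainTheorem2 :
  jones knot_5_1 = jones knot_10_132 /\ Kh knot_5_1 <> Kh knot_10_132.
Proof.
split; first exact: jones_eq.
move/Kh_dim => eqdim; have := cohomology_state0 adequate_10_132.
rewrite -eqdim cohomology_eq0 ?dimv0 // => x.
apply/negP => /andP[/eqP hx _]; have := height_ge x; rewrite hx.
by rewrite (_ : n_minus knot_5_1 = 5%N) // (_ : n_minus knot_10_132 = 7%N).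
Qed.
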